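(* Let $(X_k)_{k\ge1}$ be a Markov chain on a finite state space $E$ whose transition matrix $P=(p_{ij})$ is irreducible and aperiodic and reversible with respect to its stationary distribution $\pi$, i.e. $\pi_i p_{ij}=\pi_j p_{ji}$ for all $i,j\in E$. Assume the chain is in the stationary state ($X_1\sim\pi$). Let $\lambda$ be the second largest eigenvalue of $P$ and put $\lambda_0=\max(0,\lambda)$. Let $f:E\to[0,1]$, let $\mu=\mathbb{E}_\pi[f(X_k)]$ with $0<\mu<1$, write $\bar\mu=1-\mu$, and let $S_n=\sum_{k=1}^n f(X_k)$. Then for every $\varepsilon>0$ with $\mu+\varepsilon<1$ and every $n\ge1$, $$\mathbb{P}_\pi[S_n\ge n(\mu+\varepsilon)]\le\left[\frac{\mu+\bar\mu\lambda_0}{1-2(\bar\mu-\varepsilon)/(1+\sqrt\Delta)}\right]^{n(\mu+\varepsilon)}\left[\frac{\bar\mu+\mu\lambda_0}{1-2(\mu+\varepsilon)/(1+\sqrt\Delta)}\right]^{n(\bar\mu-\varepsilon)}\le\exp\Big\{-2\,\frac{1-\lambda_0}{1+\lambda_0}\,n\varepsilon^2\Big\},$$ where $$\Delta=1+\frac{4\lambda_0(\mu+\varepsilon)(\bar\mu-\varepsilon)}{\mu\bar\mu(1-\lambda_0)^2}.$$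
   Context: Reversibility implies all eigenvalues of $P$ are real; list them as $1=\lambda_1>\lambda_2\ge\lambda_3\ge\cdots$ (with multiplicity), and the ''second largest eigenvalue'' is $\lambda=\lambda_2$. $\mathbb{P}_\pi$ denotes probability for the chain started from its stationary distribution $\pi$. *)

(* Defs.v *)
From HB Require Import structures.
From mathcomp Require Import all_boot all_order all_algebra.
From mathcomp Require Import reals sequences exp.
Set Implicit Arguments. Unset Strict Implicit. Unset Printing Implicit Defensive.
Import Order.TTheory GRing.Theory Num.Theory.
Local Open Scope ring_scope.

Section MC.
Variables (R : realType) (N : nat).

Definition mxpow (P : 'M[R]_N) (k : nat) : 'M[R]_N := iter k (mulmx P) 1%:M.

Definition stochastic (P : 'M[R]_N) : Prop :=
  (forall i j, 0 <= P i j) /\ (forall i, \sum_j P i j = 1).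

Definition irreducible (P : 'M[R]_N) : Prop :=
  forall i j, exists k, 0 < mxpow P k i j.

(* the period of every state, gcd{k >= 1 : P^k(i,i) > 0}, equals 1 *)
Definition aperiodic (P : 'M[R]_N) : Prop :=
  forall i (d : nat), (forall k, (0 < k)%N -> 0 < mxpow P k i i -> (d %| k)%N) -> d = 1%N.

Definition distribution (pi : 'I_N -> R) : Prop :=
  (forall i, 0 <= pi i) /\ \sum_i pi i = 1.

Definition stationary (P : 'M[R]_N) (pi : 'I_N -> R) : Prop :=
  distribution pi /\ forall j, \sum_i pi i * P i j = pi j.

Definition reversible (P : 'M[R]_N) (pi : 'I_N -> R) : Prop :=
  forall i j, pi i * P i j = pi j * P j i.

(* lambda is the second largest eigenvalue (with multiplicity):
   the characteristic polynomial splits as prod (X - a) over the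
   non-increasingly sorted list s of eigenvalues, and lambda = s_2 *)
Definition second_eigenvalue (P : 'M[R]_N) (lam : R) : Prop :=
  exists s : seq R, [/\ sorted (fun a b => b <= a) s, (1 < size s)%N,
    char_poly P = \prod_(a <- s) ('X - a%:P) & lam = s`_1].

Fixpoint chain_weight (P : 'M[R]_N) (x : 'I_N) (s : seq 'I_N) : R :=
  if s is y :: s' then P x y * chain_weight P y s' else 1.

Definition path_prob (P : 'M[R]_N) (pi : 'I_N -> R) (xs : seq 'I_N) : R :=
  if xs is x :: s then pi x * chain_weight P x s else 1.

Definition prob_Sn_ge (P : 'M[R]_N) (pi : 'I_N -> R) (f : 'I_N -> R)
    (n : nat) (c : R) : R :=
  \sum_(xs : n.-tuple 'I_N | c <= \sum_(x <- xs) f x) path_prob P pi xs.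

End MC.

(* Main.v *)
Require Import Defs.
From HB Require Import structures.
From mathcomp Require Import all_boot all_order all_algebra.
From mathcomp Require Import all_classical complex.
From mathcomp Require Import reals topology normedtype sequences derive exp.
From mathcomp Require Import ring lra.
Set Implicit Arguments. Unset Strict Implicit. Unset Printing Implicit Defensive.
Import Order.TTheory GRing.Theory Num.Theory.
Import numFieldNormedType.Exports.
Local Open Scope ring_scope.

(** Write [l = max (0, lambda)], [p = mu], [a = mu + eps], and let [A], [B] be
    the two bases of the bound.  By the spectral theorem, in [l^2(pi)] the
    matrix [P] is dominated by [Q = l I + (1 - l) E_pi], where [E_pi] is the
    projection onto the constants.  For [t] and
    [theta] with [(1 - l) (p / (theta e^{-t} - l) + (1 - p) / (theta - l)) = 1],
    Cauchy-Schwarz and the convexity of [u |-> 1 / (e^u - l)] show that the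
    tilted form of [Q] is at most [theta], so that [E e^{t S_n} <= theta^n].
    On this curve the Chernoff exponent [a ln (theta e^{-t}) + (1 - a) ln theta]
    is minimal at [theta e^{-t} = A], [theta = B].  Hence it is enough to
    compare it with the exponent at [t = 4 eps (1 - l) / (1 + l)] and
    [theta = exp (t p + t^2 (1 + l) / (8 (1 - l)))],
    which is on the right side of the curve by Hoeffding's lemma applied with
    the weights [(p + (1 - p) l) / (1 + l)] and [(1 - p + p l) / (1 + l)]. *)

(** * Elementary inequalities *)

Lemma ge0_derive_ge0 (R : realType) (f df : R -> R) :
  (forall x : R, is_derive x 1 f (df x)) -> f 0 = 0 ->
  (forall x, 0 <= x -> 0 <= df x) -> forall x, 0 <= x -> 0 <= f x.
Proof.
move=> fd f0 df0 x x0; rewrite -f0.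
apply: (@ger0_derive1_le_cc _ f 0 x) => //.
- move=> y; rewrite in_itv/= => /andP[y0 _].
  by have fdy := fd y; rewrite derive1E derive_val; apply/df0/ltW.
- apply: derivable_within_continuous => y _.
  have fdy := fd y; exact: ex_derive.
- by rewrite in_itv/= lexx.
- by rewrite in_itv/= lexx x0.
Qed.

(** This is tanh(t / 2) <= t / 2 with denominators cleared. *)
Lemma expR_tanh_le (R : realType) (t : R) : 0 <= t ->
  2 * (expR t - 1) <= t * (expR t + 1).
Proof.
move=> t0; rewrite -subr_ge0.
pose f (x : R) := x * (expR x + 1) - 2 * (expR x - 1).
apply: (@ge0_derive_ge0 _ f (fun x => 1 + (x - 1) * expR x)) => //.
- move=> x; apply: is_derive_eq; rewrite /GRing.scale/=; ring.
- by rewrite /f expR0; ring.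
move=> x _; have := expR_ge1Dx (- x); rewrite expRN => h.
have e0 := expR_gt0 x.
have : (1 - x) * expR x <= 1 by rewrite -ler_pdivlMr// mul1r.
lra.
Qed.

(** Hoeffding's lemma for a variable with values 1 and -1. The quotient [D * E] of the two sides is
    1 at 0 and decreases on the half-line: the sign of its derivative comes down to the tanh
    bound. *)
Lemma hoeffding_two_point (R : realType) (p q t : R) : 0 <= p -> 0 <= q ->
  p + q = 1 -> 0 <= t ->
  p * expR t + q * expR (- t) <= expR ((p - q) * t + t ^+ 2 / 2).
Proof.
move=> p0 q0 pq t0.
pose D (x : R) := p * expR x + q * expR (- x).
pose M (x : R) := p * expR x - q * expR (- x).
pose E (x : R) := expR (- ((p - q) * x + x ^+ 2 / 2)).
suff : 0 <= 1 - D t * E t.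
  by rewrite /E expRN subr_ge0 ler_pdivrMr ?expR_gt0// mul1r.
apply: (@ge0_derive_ge0 _ (fun x => 1 - D x * E x)
  (fun x => ((p - q + x) * D x - M x) * E x)) => //.
- by move=> x; apply: is_derive_eq; rewrite /GRing.scale/= /D /E /M; field.
- rewrite /D /E oppr0 expR0 !mulr1 pq mulr0 expr0n/= mul0r addr0 oppr0 expR0.
  ring.
move=> x x0; apply: mulr_ge0; last exact: expR_ge0.
have := expR_tanh_le x0; have : 1 <= expR x by rewrite -expR0 ler_expR.
rewrite /D /M expRN; move: (expR x) => z z1 hz.
have z0 : 0 < z by lra.
suff : 0 <= ((p - q + x) * (p * z ^+ 2 + q) - (p * z ^+ 2 - q)).
  move=> h.
  have -> : (p - q + x) * (p * z + q / z) - (p * z - q / z) =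
    ((p - q + x) * (p * z ^+ 2 + q) - (p * z ^+ 2 - q)) / z by field; rewrite gt_eqF.
  by rewrite divr_ge0// ltW.
have -> : q = 1 - p by lra.
have hq : 0 <= p * (1 - p) by apply: mulr_ge0; lra.
(* With q = 1 - p the goal reads x (p z^2 + q) >= 2 p q (z^2 - 1). The gap in [k1] is (p z - q)^2,
   and [h2] is the tanh bound times p q (z + 1). *)
have k1 : p * (1 - p) * (z + 1) ^+ 2 <= p * z ^+ 2 + (1 - p).
  have := sqr_ge0 (p * z - (1 - p)); lra.
have h1 : x * (p * (1 - p) * (z + 1) ^+ 2) <= x * (p * z ^+ 2 + (1 - p)).
  exact: ler_wpM2l.
have h2 : p * (1 - p) * (z + 1) * (2 * (z - 1)) <= p * (1 - p) * (z + 1) * (x * (z + 1)).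
  by apply: ler_wpM2l => //; apply: mulr_ge0 => //; lra.
lra.
Qed.

(** Jensen's inequality for exp at the points x and -x, from the tangent line at their weighted
    mean. *)
Lemma weighted_exp_ge (R : realType) (p q x : R) : 0 <= p -> 0 <= q ->
  p + q = 1 -> expR ((p - q) * x) <= p * expR x + q * expR (- x).
Proof.
move=> p0 q0 pq.
have e0 := expR_gt0 ((p - q) * x).
have -> : expR x = expR ((p - q) * x) * expR (x - (p - q) * x).
  by rewrite -expRD; congr expR; ring.
have -> : expR (- x) = expR ((p - q) * x) * expR (- x - (p - q) * x).
  by rewrite -expRD; congr expR; ring.
rewrite [leRHS](_ : _ = expR ((p - q) * x) *
  (p * expR (x - (p - q) * x) + q * expR (- x - (p - q) * x))); last by ring.
apply: ler_peMr; first exact: ltW.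
have h1 := ler_wpM2l p0 (expR_ge1Dx (x - (p - q) * x)).
have h2 := ler_wpM2l q0 (expR_ge1Dx (- x - (p - q) * x)).
apply: (le_trans _ (lerD h1 h2)).
by have -> : q = 1 - p by [lra]; lra.
Qed.

(* The tangent inequality for the convex function [u |-> 1 / (exp u - l)]. *)
Lemma tangent_inv (R : realType) (l x y : R) : 0 <= l -> l < x -> l < y ->
  (x - l)^-1 - x / (x - l) ^+ 2 * (ln y - ln x) <= (y - l)^-1.
Proof.
move=> l0 lx ly; have x0 : 0 < x by lra. have y0 : 0 < y by lra.
have h : ln x - ln y <= x / y - 1.
  rewrite -ln_div ?posrE//.
  have := @le_ln1Dx R (x / y - 1); rewrite (_ : 1 + (x / y - 1) = x / y); last ring.
  by apply; rewrite ltrBrDr addNr divr_gt0.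
have k0 : 0 < x / (x - l) ^+ 2 by rewrite divr_gt0// exprn_gt0// subr_gt0.
have := ler_wpM2l (ltW k0) h.
suff : (x - l)^-1 + x / (x - l) ^+ 2 * (x / y - 1) <= (y - l)^-1 by lra.
rewrite -subr_ge0.
have -> : (y - l)^-1 - ((x - l)^-1 + x / (x - l) ^+ 2 * (x / y - 1)) =
  l * (x - y) ^+ 2 / (y * (y - l) * (x - l) ^+ 2).
  by field; rewrite !subr_eq0 (gt_eqF ly) (gt_eqF lx) (gt_eqF y0).
apply: divr_ge0; rewrite mulr_ge0 ?sqr_ge0//.
apply: mulr_ge0; lra.
Qed.

(** * The optimal tilt *)

(** Lagrange multipliers in the coordinates ln x and ln y, where the constraint is convex and the
    objective linear: [ca] and [cb] say that the gradients are proportional with multiplier [k], and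
    adding the tangent inequalities at [A] and [B] gives a global minimum. *)
Lemma critical_point_min (R : realType) (l p q a b k A B x y : R) :
  0 <= l < 1 -> 0 <= p -> 0 <= q -> 0 < k -> l < A -> l < B ->
  (1 - l) * (p / (A - l) + q / (B - l)) = 1 ->
  (1 - l) * (p * A / (A - l) ^+ 2) = k * a ->
  (1 - l) * (q * B / (B - l) ^+ 2) = k * b ->
  l < x -> l < y -> (1 - l) * (p / (x - l) + q / (y - l)) <= 1 ->
  a * ln A + b * ln B <= a * ln x + b * ln y.
Proof.
move=> /andP[l0 l1] p0 q0 k0 lA lB curve ca cb lx ly hxy.
have Lp : 0 <= (1 - l) * p by rewrite mulr_ge0//; lra.
have Lq : 0 <= (1 - l) * q by rewrite mulr_ge0//; lra.
have h1 := ler_wpM2l Lp (tangent_inv l0 lA lx).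
have h2 := ler_wpM2l Lq (tangent_inv l0 lB ly).
have e1 : (1 - l) * p * ((A - l)^-1 - A / (A - l) ^+ 2 * (ln x - ln A)) =
  (1 - l) * (p / (A - l)) - k * a * (ln x - ln A).
  by rewrite -ca mulrBr !mulrA.
have e2 : (1 - l) * q * ((B - l)^-1 - B / (B - l) ^+ 2 * (ln y - ln B)) =
  (1 - l) * (q / (B - l)) - k * b * (ln y - ln B).
  by rewrite -cb mulrBr !mulrA.
rewrite e1 in h1; rewrite e2 in h2.
rewrite -(ler_pM2l k0).
lra.
Qed.

Section Optimum.
Variables (R : realType) (l p a v : R).
Hypotheses (l01 : 0 <= l < 1) (p01 : 0 < p < 1) (a01 : 0 < a < 1).
Hypotheses (v01 : 0 < v <= 1).
(** [v] stands for 2 / (1 + sqrt Delta), a root of this quadratic. Clearing denominators reduces the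
    curve equation and both criticality conditions to it. *)
Hypothesis vE : (1 - l) ^+ 2 * p * (1 - p) * (1 - v) = l * a * (1 - a) * v ^+ 2.

Let A := (p + (1 - p) * l) / (1 - (1 - a) * v).
Let B := (1 - p + p * l) / (1 - a * v).

Let den_A_gt0 : 0 < 1 - (1 - a) * v.
Proof. by case/andP: a01 => ? ?; case/andP: v01 => ? ?; nra. Qed.
Let den_B_gt0 : 0 < 1 - a * v.
Proof. by case/andP: a01 => ? ?; case/andP: v01 => ? ?; nra. Qed.

Let U := (1 - l) * p + l * (1 - a) * v.
Let V := (1 - l) * (1 - p) + l * a * v.

Let U_gt0 : 0 < U.
Proof.
case/andP: a01 => ? ?; case/andP: v01 => ? ?; case/andP: l01 => ? ?.
case/andP: p01 => ? ?; rewrite /U ltr_pwDl// ?mulr_gt0 ?mulr_ge0//; lra.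
Qed.
Let V_gt0 : 0 < V.
Proof.
case/andP: a01 => ? ?; case/andP: v01 => ? ?; case/andP: l01 => ? ?.
case/andP: p01 => ? ?; rewrite /V ltr_pwDl// ?mulr_gt0 ?mulr_ge0//; lra.
Qed.

Let AE : A - l = U / (1 - (1 - a) * v).
Proof. by rewrite /A /U; field; rewrite gt_eqF. Qed.
Let BE : B - l = V / (1 - a * v).
Proof. by rewrite /B /V; field; rewrite gt_eqF. Qed.

Lemma base_gtl : l < A.
Proof. by rewrite -subr_gt0 AE divr_gt0. Qed.

Lemma base_gtr : l < B.
Proof. by rewrite -subr_gt0 BE divr_gt0. Qed.

Lemma base_curve : (1 - l) * (p / (A - l) + (1 - p) / (B - l)) = 1.
Proof.
rewrite AE BE; apply/eqP; rewrite -subr_eq0; apply/eqP.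
have -> : (1 - l) * (p / (U / (1 - (1 - a) * v)) + (1 - p) / (V / (1 - a * v))) - 1 =
  ((1 - l) ^+ 2 * p * (1 - p) * (1 - v) - l * a * (1 - a) * v ^+ 2) / (U * V).
  rewrite /U /V; field.
  by rewrite -/U -/V !gt_eqF.
by rewrite vE subrr mul0r.
Qed.

(** The Lagrange multiplier at (A, B). *)
Let k := v * (p + (1 - p) * l) * (1 - p + p * l) / (U * V).

Let k_gt0 : 0 < k.
Proof.
case/andP: v01 => ? ?; case/andP: l01 => ? ?; case/andP: p01 => ? ?.
rewrite /k divr_gt0 ?mulr_gt0//.
  by rewrite ltr_pwDl// mulr_ge0//; lra.
by rewrite ltr_pwDl ?mulr_ge0//; lra.
Qed.

Let criticall : (1 - l) * (p * A / (A - l) ^+ 2) = k * a.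
Proof.
rewrite AE; apply/eqP; rewrite -subr_eq0; apply/eqP.
have -> : (1 - l) * (p * A / (U / (1 - (1 - a) * v)) ^+ 2) - k * a =
  (p + (1 - p) * l) * ((1 - l) ^+ 2 * p * (1 - p) * (1 - v) -
     l * a * (1 - a) * v ^+ 2) / (U ^+ 2 * V).
  rewrite /k /A /U /V; field.
  by rewrite -/U -/V !gt_eqF.
by rewrite vE subrr mulr0 mul0r.
Qed.

Let criticalr : (1 - l) * ((1 - p) * B / (B - l) ^+ 2) = k * (1 - a).
Proof.
rewrite BE; apply/eqP; rewrite -subr_eq0; apply/eqP.
have -> : (1 - l) * ((1 - p) * B / (V / (1 - a * v)) ^+ 2) - k * (1 - a) =
  (1 - p + p * l) * ((1 - l) ^+ 2 * p * (1 - p) * (1 - v) -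
     l * a * (1 - a) * v ^+ 2) / (U * V ^+ 2).
  rewrite /k /B /U /V; field.
  by rewrite -/U -/V !gt_eqF.
by rewrite vE subrr mulr0 mul0r.
Qed.

Lemma base_min (x y : R) : l < x -> l < y ->
  (1 - l) * (p / (x - l) + (1 - p) / (y - l)) <= 1 ->
  a * ln A + (1 - a) * ln B <= a * ln x + (1 - a) * ln y.
Proof.
case/andP: p01 => ? ?.
apply: (critical_point_min l01 _ _ k_gt0 base_gtl base_gtr base_curve) => //; lra.
Qed.

(* Compare the critical point of the weights (a, 1 - a), which is (A, B), with
   that of the weights (p, 1 - p), which is (1, 1). *)
Lemma base_le : p < a -> ln A <= ln B.
Proof.
move=> pa; case/andP: (l01) => l0 l1; case/andP: (p01) => p0 p1.
have L0 : 1 - l != 0 by rewrite gt_eqF// subr_gt0.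
have curve1 : (1 - l) * (p / (1 - l) + (1 - p) / (1 - l)) = 1 by field.
have h1 : a * ln A + (1 - a) * ln B <= 0.
  have := base_min l1 l1; rewrite ln1 !mulr0 addr0; apply.
  by rewrite curve1.
have h2 : 0 <= p * ln A + (1 - p) * ln B.
  have k1 : 0 < (1 - l)^-1 by rewrite invr_gt0 subr_gt0.
  have := critical_point_min l01 (ltW p0) _ k1 l1 l1 curve1 _ _ base_gtl base_gtr.
  move=> /(_ p (1 - p)); rewrite ln1 !mulr0 addr0; apply.
  - by rewrite subr_ge0 ltW.
  - by field.
  - by field.
  - by rewrite base_curve.
have ap : 0 < a - p by rewrite subr_gt0.
(* [h2] minus [h1] is (a - p) (ln B - ln A) >= 0. *)
rewrite -subr_ge0 -(pmulr_rge0 _ ap); lra.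
Qed.

End Optimum.

(* With [z = u - t / 2] and weights [(1, l) / (1 + l)], convexity of the
   exponential gives [exp z + l exp (- z) >= (1 + l) exp (z (1 - l) / (1 + l))],
   and [u] is chosen so that the right-hand side is Hoeffding's majorant. *)
Lemma gaussian_point (R : realType) (l p t : R) : 0 <= l < 1 -> 0 < p < 1 ->
  0 < t ->
  let u := t * p + t ^+ 2 / (8 * ((1 - l) / (1 + l))) in
  [/\ l < expR (u - t), l < expR u &
   (1 - l) * (p / (expR (u - t) - l) + (1 - p) / (expR u - l)) <= 1].
Proof.
move=> /andP[l0 l1] /andP[p0 p1] t0 u.
have g0 : 0 < (1 - l) / (1 + l) by rewrite divr_gt0//; lra.
have l10 : 0 < 1 + l by lra.
have l1n : 1 + l != 0 by rewrite gt_eqF.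
have l2n : 1 - l != 0 by rewrite gt_eqF// subr_gt0.
have pl : 0 < (1 - p) * (1 - l) by rewrite mulr_gt0//; lra.
have pl2 : 0 < p * (1 - l) by rewrite mulr_gt0//; lra.
have pl3 : 0 <= (1 - p) * l by rewrite mulr_ge0//; lra.
have pl4 : 0 <= p * l by rewrite mulr_ge0//; lra.
have u0 : 0 < u.
  by rewrite /u addr_gt0 ?mulr_gt0// invr_gt0 mulr_gt0.
pose z := u - t / 2.
have key : (p + (1 - p) * l) * expR (t / 2) + (1 - p + p * l) * expR (- (t / 2)) <=
    expR z + l * expR (- z).
  have H := @hoeffding_two_point R ((p + (1 - p) * l) / (1 + l))
     ((1 - p + p * l) / (1 + l)) (t / 2).
  have W := @weighted_exp_ge R (1 / (1 + l)) (l / (1 + l)) z.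
  have {}H : ((p + (1 - p) * l) / (1 + l)) * expR (t / 2) +
     ((1 - p + p * l) / (1 + l)) * expR (- (t / 2)) <=
     expR ((1 / (1 + l) - l / (1 + l)) * z).
    have -> : (1 / (1 + l) - l / (1 + l)) * z =
       ((p + (1 - p) * l) / (1 + l) - (1 - p + p * l) / (1 + l)) * (t / 2) +
       (t / 2) ^+ 2 / 2.
      by rewrite /z /u; field; rewrite l1n l2n.
    apply: H; rewrite ?divr_ge0//; try lra.
    by field.
  have {}W : expR ((1 / (1 + l) - l / (1 + l)) * z) <=
     1 / (1 + l) * expR z + l / (1 + l) * expR (- z).
    by apply: W; rewrite ?divr_ge0//; try lra; field.
  have := le_trans H W.
  rewrite -(ler_pM2r l10).
  by rewrite [leLHS](_ : _ = (p + (1 - p) * l) * expR (t / 2) + (1 - p + p * l) * expR (- (t / 2)));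
    [rewrite [leRHS](_ : _ = expR z + l * expR (- z)) //|]; field.
have y1 : 1 < expR u by rewrite expR_gt1.
(* Multiplying [key] by exp z gives the curve inequality for x = exp (u - t) and y = exp u, cleared
   of denominators. *)
have xyl : (p + (1 - p) * l) * expR u + (1 - p + p * l) * expR (u - t) <=
    expR (u - t) * expR u + l.
  have := ler_wpM2l (expR_ge0 z) key; rewrite !mulrDr.
  have -> : expR u = expR z * expR (t / 2) by rewrite -expRD; congr expR; rewrite /z; field.
  have -> : expR (u - t) = expR z * expR (- (t / 2)).
    by rewrite -expRD; congr expR; rewrite /z; field.
  have e1 : expR (- z) = (expR z)^-1 by rewrite expRN.
  have e2 : expR (- (t / 2)) = (expR (t / 2))^-1 by rewrite expRN.
  have e3 : expR z != 0 by rewrite gt_eqF ?expR_gt0.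
  have e4 : expR (t / 2) != 0 by rewrite gt_eqF ?expR_gt0.
  have e5 : expR z * (l * expR (- z)) = l by rewrite e1; field.
  have e6 : expR z * expR (- (t / 2)) * (expR z * expR (t / 2)) = expR z * expR z.
    by rewrite e2; field.
  by rewrite e5 e6; move: (expR z) (expR (t / 2)) (expR (- (t / 2))) => *; lra.
move: (expR (u - t)) (expR u) y1 xyl => x y y1 xyl.
have y2 : 0 < y - (1 - p + p * l) by lra.
(* [xyl] says (x - p - (1 - p) l) (y - (1 - p) - p l) >= (1 - l)^2 p (1 - p). Since y > 1 makes the
   second factor positive, the point is on the upper branch of the hyperbola. *)
have x2 : p + (1 - p) * l < x.
  rewrite -subr_gt0 -(pmulr_rgt0 _ y2).
  have : 0 < (1 - l) ^+ 2 * p * (1 - p) by rewrite !mulr_gt0 ?exprn_gt0//; lra.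
  lra.
have xl : l < x by lra.
have yl : l < y by lra.
split => //.
have xl0 : 0 < x - l by lra. have yl0 : 0 < y - l by lra.
have -> : (1 - l) * (p / (x - l) + (1 - p) / (y - l)) =
  (1 - l) * (p * (y - l) + (1 - p) * (x - l)) / ((x - l) * (y - l)).
  by field; rewrite !gt_eqF.
rewrite ler_pdivrMr ?mulr_gt0// mul1r; lra.
Qed.

(** * Spectral theorem for real symmetric matrices *)

Lemma char_poly_similar (R : comUnitRingType) n (A B Q : 'M[R]_n) :
  Q \in unitmx -> Q *m A = B *m Q -> char_poly A = char_poly B.
Proof.
move=> Qu QA.
have Qd : \det (map_mx polyC Q) * \det (map_mx polyC (invmx Q)) = 1.
  by rewrite -det_mulmx -map_mxM mulmxV// map_mx1 det1.
have H : map_mx polyC Q *m char_poly_mx A = char_poly_mx B *m map_mx polyC Q.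
  rewrite /char_poly_mx mulmxBr mulmxBl -!map_mxM QA; congr (_ - _).
  by rewrite scalar_mxC.
rewrite /char_poly -[LHS]mul1r -Qd mulrAC -det_mulmx H det_mulmx -mulrA Qd.
by rewrite mulr1.
Qed.

Section ComplexMatrix.
Variable R : rcfType.
Local Notation rc := (map_mx (real_complex R)).
Local Notation "M ^t*" := (map_mx Num.conj (M^T)) (at level 30).

Lemma complex_mx_inj m n (A B A' B' : 'M[R]_(m, n)) :
  rc A + 'i%C *: rc B = rc A' + 'i%C *: rc B' -> A = A' /\ B = B'.
Proof.
move=> /matrixP H; split; apply/matrixP => i j; have := H i j; rewrite !mxE => /eqP;
  by rewrite eq_complex /= => /andP[/eqP + /eqP]; simpc.
Qed.

Lemma complex_mx_split m n (V : 'M[R[i]]_(m, n)) :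
  exists U W, V = rc U + 'i%C *: rc W.
Proof.
exists (map_mx (@complex.Re R) V), (map_mx (@complex.Im R) V).
by apply/matrixP => i j; rewrite !mxE [LHS]complexE.
Qed.

(* The real and imaginary parts [U], [W] of a unitary diagonalisation of [S]. *)
Lemma symmetric_spectral n (S : 'M[R]_n) : S^T = S ->
  exists (U W : 'M[R]_n) (e : 'rV[R]_n),
  [/\ U^T *m U + W^T *m W = 1%:M, U *m U^T + W *m W^T = 1%:M,
      W *m U^T = U *m W^T, U *m S = diag_mx e *m U & W *m S = diag_mx e *m W] /\
  char_poly S = \prod_i ('X - (e 0 i)%:P).
Proof.
(* [S] is diagonalised as a Hermitian complex matrix; its eigenvalues are real, and each complex
   coordinate of a real vector is kept as a pair of real ones. *)
move=> Ssym; pose A := rc S.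
have Areal : A \is a mxOver Num.real.
  by apply/mxOverP => i j; rewrite mxE; apply/complex_realP; exists (S i j).
have Aherm : A \is hermsymmx.
  by apply: realsym_hermsym => //; apply/eqP; rewrite expr0 scale1r map_mx_id// map_trmx Ssym.
have := hermitian_normalmx Aherm => /orthomx_spectralP.
have := hermitian_spectral_diag_real Aherm.
have := spectral_unitarymx A.
move: (spectralmx A) (spectral_diag A) => V d Vun dreal AE.
have Vunit := unitarymx_unit Vun.
rewrite invmx_unitary// in AE.
have /unitarymxP VV := Vun.
have VV' := mulmx1C VV.
have VA : V *m A = diag_mx d *m V by rewrite AE !mulmxA VV mul1mx.
have [e de] : exists e, d = rc e.
  exists (map_mx (@complex.Re R) d); apply/rowP => k; rewrite !mxE RRe_real//.
  exact: (mxOverP dreal).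
have rcD : rc (diag_mx e) = diag_mx d by rewrite map_diag_mx de.
have charE : char_poly S = \prod_i ('X - (e 0 i)%:P).
  apply: (map_poly_inj (real_complex R)).
  rewrite map_char_poly -/A (char_poly_similar Vunit VA) char_poly_trig; last first.
    exact: diag_mx_is_trig.
  rewrite rmorph_prod; apply: eq_bigr => k _.
  by rewrite rmorphB /= map_polyX map_polyC de !mxE eqxx mulr1n.
have [U [W VE]] := complex_mx_split V.
have VtE : V^t* = rc U^T - 'i%C *: rc W^T.
  rewrite VE; apply/matrixP => i j; rewrite !mxE.
  have -> (z : R[i]) : Num.conj z = conjc z by [].
  by simpc.
exists U, W, e; split => //.
have toC (B : 'M[R]_n) : rc B = rc B + 'i%C *: rc 0 by rewrite map_mx0 scaler0 addr0.
have ii : 'i%C * 'i%C = -1 :> R[i] by rewrite -expr2 sqr_i.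
have mulI (B C : 'M[R]_n) : 'i%C *: rc B *m ('i%C *: rc C) = - (rc (B *m C)).
  by rewrite -scalemxAl -scalemxAr scalerA ii scaleN1r map_mxM.
(* The relations are the real and imaginary parts of V V* = 1, V* V = 1 and V S = D V. *)
have [h1 h2] : U *m U^T + W *m W^T = 1%:M /\ W *m U^T - U *m W^T = 0.
  apply: complex_mx_inj; rewrite -toC map_mx1 -VV VtE VE.
  rewrite mulmxBr !mulmxDl mulI -!scalemxAl -!scalemxAr -!map_mxM.
  by apply/matrixP => i j; rewrite !mxE /= !raddfD !raddfN /= !mulrDr; ring.
have [h3 h4] : U^T *m U + W^T *m W = 1%:M /\ U^T *m W - W^T *m U = 0.
  apply: complex_mx_inj; rewrite -toC map_mx1 -VV' VtE VE.
  rewrite mulmxBl !mulmxDr mulI -!scalemxAl -!scalemxAr -!map_mxM.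
  by apply/matrixP => i j; rewrite !mxE /= !raddfD !raddfN /= !mulrDr; ring.
have [h5 h6] : U *m S = diag_mx e *m U /\ W *m S = diag_mx e *m W.
  apply: complex_mx_inj; rewrite !map_mxM rcD scalemxAl [X in _ = _ + X]scalemxAr -mulmxDl -mulmxDr.
  by rewrite -VE VA.
by split => //; apply/eqP; rewrite -subr_eq0 h2.
Qed.

End ComplexMatrix.

(** * Spectral gap of a reversible chain *)

Lemma diag_form (R : comPzRingType) n (d y : 'rV[R]_n) :
  (y *m diag_mx d *m y^T) 0 0 = \sum_k d 0 k * y 0 k ^+ 2.
Proof.
by rewrite mul_mx_diag !mxE; apply: eq_bigr => k _; rewrite !mxE; ring.
Qed.

Section SpectralGap.
Variables (R : realType) (N : nat) (P : 'M[R]_N) (pi : 'I_N -> R).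
Hypothesis P_stoch : stochastic P.
Hypothesis P_irr : irreducible P.
Hypothesis pi_stat : stationary P pi.
Hypothesis P_rev : reversible P pi.

Let P_ge0 i j : 0 <= P i j. Proof. by case: P_stoch. Qed.
Let P_sum i : \sum_j P i j = 1. Proof. by case: P_stoch. Qed.
Let pi_ge0 i : 0 <= pi i. Proof. by case: pi_stat => -[]. Qed.

Lemma mxpow_ge0 k i j : 0 <= mxpow P k i j.
Proof.
elim: k i j => [|k IH] i j; first by rewrite mxE; case: (i == j).
by rewrite mxE sumr_ge0// => h _; rewrite mulr_ge0.
Qed.

Lemma stationary_mxpow k j : \sum_i pi i * mxpow P k i j = pi j.
Proof.
elim: k j => [|k IH] j.
  rewrite (bigD1 j)//= mxE eqxx mulr1 big1 ?addr0// => i ij.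
  by rewrite mxE (negbTE ij) mulr0.
under eq_bigr do rewrite mxE mulr_sumr.
rewrite exchange_big /= -[RHS]IH; apply: eq_bigr => h _.
under eq_bigr do rewrite mulrA.
by rewrite -mulr_suml; case: pi_stat => _ ->.
Qed.

(** Some state has positive mass, and irreducibility carries mass from it to [j] under a power of
    [P] that preserves [pi]. *)
Lemma stationary_gt0 j : 0 < pi j.
Proof.
have [i pi_i] : exists i, 0 < pi i.
  apply/existsP; rewrite -[X in is_true X]negbK negb_exists; apply/negP => /forallP H.
  have : \sum_i pi i = 0.
    apply: big1 => i _; apply/eqP; have := H i; rewrite -leNgt => h.
    by rewrite eq_le h pi_ge0.
  by case: pi_stat => -[_ ->] _ /eqP; rewrite oner_eq0.
have [k hk] := P_irr i j.
rewrite -(stationary_mxpow k j) (bigD1 i)//= ltr_pwDl ?mulr_gt0//.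
by apply: sumr_ge0 => h _; rewrite mulr_ge0// mxpow_ge0.
Qed.

(** Expand the square: both marginals of the weights pi_i P_ij are [pi], the second one by
    reversibility. *)
Lemma dirichlet_form (g : 'I_N -> R) :
  \sum_i pi i * g i ^+ 2 - \sum_i \sum_j pi i * P i j * (g i * g j) =
  2^-1 * \sum_i \sum_j pi i * P i j * (g i - g j) ^+ 2.
Proof.
have e1 : \sum_i pi i * g i ^+ 2 = \sum_i \sum_j pi i * P i j * g i ^+ 2.
  apply: eq_bigr => i _; rewrite -mulr_suml -mulr_sumr P_sum; ring.
have e2 : \sum_i \sum_j pi i * P i j * g i ^+ 2 = \sum_i \sum_j pi i * P i j * g j ^+ 2.
  rewrite exchange_big /=; apply: eq_bigr => i _; apply: eq_bigr => j _.
  by rewrite P_rev.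
have -> : \sum_i \sum_j pi i * P i j * (g i - g j) ^+ 2 =
   \sum_i \sum_j pi i * P i j * g i ^+ 2 + \sum_i \sum_j pi i * P i j * g j ^+ 2
   - 2 * \sum_i \sum_j pi i * P i j * (g i * g j).
  rewrite mulr_sumr -big_split -sumrB; apply: eq_bigr => i _ /=.
  rewrite mulr_sumr -big_split -sumrB; apply: eq_bigr => j _ /=; ring.
by rewrite -e2 e1; field.
Qed.

Lemma dirichlet_form_ge0 (g : 'I_N -> R) :
  \sum_i \sum_j pi i * P i j * (g i * g j) <= \sum_i pi i * g i ^+ 2.
Proof.
rewrite -subr_ge0 dirichlet_form; apply: mulr_ge0; first by rewrite invr_ge0.
by apply: sumr_ge0 => i _; apply: sumr_ge0 => j _; rewrite mulr_ge0 ?sqr_ge0// mulr_ge0.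
Qed.

(** Every square in the Dirichlet form vanishes, so [g] is constant along transitions of positive
    probability, hence everywhere by irreducibility. This makes the eigenvalue 1 simple. *)
Lemma dirichlet_form_eq0 (g : 'I_N -> R) :
  \sum_i \sum_j pi i * P i j * (g i * g j) = \sum_i pi i * g i ^+ 2 ->
  forall i j, g i = g j.
Proof.
move=> /eqP; rewrite eq_sym -subr_eq0 dirichlet_form mulf_eq0 invr_eq0 pnatr_eq0 /=.
have nn i j : 0 <= pi i * P i j * (g i - g j) ^+ 2.
  by rewrite mulr_ge0 ?sqr_ge0// mulr_ge0.
rewrite psumr_eq0 => [/allP H i j|i _]; last exact: sumr_ge0.
have step a b : 0 < P a b -> g a = g b.
  move=> Pab; have := H a (mem_index_enum a); rewrite /= psumr_eq0//.
  move=> /allP/(_ b (mem_index_enum b)) /=.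
  by rewrite !mulf_eq0 (gt_eqF (stationary_gt0 a)) (gt_eqF Pab) /= orbb subr_eq0 => /eqP.
have [k] := P_irr i j; elim: k i => [|k IH] i.
  by rewrite mxE; case: eqVneq => [->|]//; rewrite ltxx.
rewrite mxE => Hs; have [h] : exists h, 0 < P i h * mxpow P k h j.
  apply/existsP; rewrite -[X in is_true X]negbK negb_exists; apply/negP => /forallP H'.
  move: Hs; rewrite ltNge => /negP; apply; apply: sumr_le0 => h _.
  by rewrite leNgt; exact: H'.
have := P_ge0 i h; rewrite le_eqVlt => /predU1P[<-|Ph]; first by rewrite mul0r ltxx.
by rewrite pmulr_rgt0// => /IH <-; exact: step.
Qed.

(** Symmetrisation of [P]: the map sending g to the row (w_i g_i) is an isometry from l^2(pi) to
    Euclidean space. It turns the form of [P] into that of [S] and the constant 1 into the unit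
    eigenvector [w]. *)
Let w : 'rV[R]_N := \row_i Num.sqrt (pi i).
Let S : 'M[R]_N := \matrix_(i, j) (w 0 i * P i j / w 0 j).

Let w_gt0 i : 0 < w 0 i. Proof. by rewrite mxE sqrtr_gt0 stationary_gt0. Qed.
Let w_sqr i : w 0 i ^+ 2 = pi i. Proof. by rewrite mxE sqr_sqrtr. Qed.

Let S_sym : S^T = S.
Proof.
apply/matrixP => i j; rewrite [LHS]mxE !mxE.
apply: (mulIf (lt0r_neq0 (mulr_gt0 (w_gt0 i) (w_gt0 j)))).
have wi := lt0r_neq0 (w_gt0 i); have wj := lt0r_neq0 (w_gt0 j).
have h := P_rev i j; rewrite -!w_sqr in h; rewrite !mxE in h wi wj *.
rewrite [LHS](_ : _ = Num.sqrt (pi j) ^+ 2 * P j i); last by field.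
by rewrite -h; field.
Qed.

Let S_form (g : 'I_N -> R) (x := \row_i (w 0 i * g i)) :
  (x *m S *m x^T) 0 0 = \sum_i \sum_j pi i * P i j * (g i * g j).
Proof.
rewrite mxE exchange_big /=; apply: eq_bigr => j _.
rewrite !mxE mulr_suml; apply: eq_bigr => i _.
have := lt0r_neq0 (w_gt0 j); rewrite -[pi i in RHS]w_sqr !mxE => wj.
by field.
Qed.

Let norm_form (g : 'I_N -> R) (x := \row_i (w 0 i * g i)) :
  (x *m x^T) 0 0 = \sum_i pi i * g i ^+ 2.
Proof.
by rewrite mxE; apply: eq_bigr => i _; rewrite -w_sqr !mxE; ring.
Qed.

Let rowE (u : 'rV[R]_N) : u = \row_i (w 0 i * (u 0 i / w 0 i)).
Proof. by apply/rowP => i; rewrite [RHS]mxE mulrC divfK// gt_eqF. Qed.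

Let sqnorm_gt0 (u : 'rV[R]_N) : u != 0 -> 0 < (u *m u^T) 0 0.
Proof.
have nn i : 0 <= u 0 i * u^T i 0 by rewrite mxE -expr2 sqr_ge0.
move=> u0; rewrite lt0r mxE sumr_ge0 ?andbT//; apply: contra_neq u0 => /eqP.
rewrite psumr_eq0// => /allP H; apply/rowP => i; rewrite [RHS]mxE.
by have := H i (mem_index_enum i); rewrite mxE -expr2 sqrf_eq0 => /eqP.
Qed.

Let eigenvalue_le1 (u : 'rV[R]_N) e : u *m S = e *: u -> u != 0 -> e <= 1.
Proof.
move=> uS u0; have := dirichlet_form_ge0 (fun i => u 0 i / w 0 i).
rewrite -S_form -norm_form -rowE uS -scalemxAl mxE.
by rewrite ger_pMl// sqnorm_gt0.
Qed.

Let eigenvector1 (u : 'rV[R]_N) : u *m S = u -> exists c, u = c *: w.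
Proof.
move=> uS; have := @dirichlet_form_eq0 (fun i => u 0 i / w 0 i).
rewrite -S_form -norm_form -rowE uS => /(_ erefl) H.
case: (pickP (fun _ : 'I_N => true)) => [i0 _|none]; last first.
  by exists 0; apply/rowP => i; have := none i.
exists (u 0 i0 / w 0 i0); apply/rowP => i; rewrite [RHS]mxE -(H i).
by rewrite divfK// gt_eqF.
Qed.

Let w_eigen : w *m S = w.
Proof.
apply/rowP => j; rewrite mxE.
under eq_bigr => i _ do rewrite [S _ _]mxE !mulrA -expr2 w_sqr.
rewrite -mulr_suml; case: pi_stat => _ ->.
by rewrite -w_sqr expr2 mulfK// gt_eqF.
Qed.

Let w_norm : (w *m w^T) 0 0 = 1.
Proof.
rewrite mxE; under eq_bigr => i _ do rewrite [w^T _ _]mxE -expr2 w_sqr.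
by case: pi_stat => -[].
Qed.

Let char_polyS : char_poly P = char_poly S.
Proof.
have wu : diag_mx w \in unitmx.
  rewrite unitmxE det_diag unitfE; apply/prodf_neq0 => i _.
  by rewrite gt_eqF.
apply: (char_poly_similar wu); apply/matrixP => i j.
by rewrite mul_diag_mx mul_mx_diag !mxE divfK//; have := w_gt0 j; rewrite mxE => /lt0r_neq0.
Qed.

(** At an eigenvalue 1 the complex eigenvector is (a + i b) w with a^2 + b^2 = 1, so its squared
    coordinate is the squared product with [w]; two such rows could not be orthogonal, hence [k0] is
    unique. *)
Let reversible_spectral : exists (U W : 'M[R]_N) (e : 'rV[R]_N) (k0 : 'I_N),
  [/\ U^T *m U + W^T *m W = 1%:M, U *m S = diag_mx e *m U,
      W *m S = diag_mx e *m W,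
      (forall x : 'rV[R]_N, (x *m U^T) 0 k0 ^+ 2 + (x *m W^T) 0 k0 ^+ 2 =
         (x *m w^T) 0 0 ^+ 2)
    & e 0 k0 = 1 /\ forall k, k != k0 -> e 0 k < 1] /\
  char_poly P = \prod_i ('X - (e 0 i)%:P).
Proof.
have [U [W [e [[UtU UU WU US WS] chE]]]] := symmetric_spectral S_sym.
rewrite -char_polyS in chE.
have rowU k : row k U *m S = e 0 k *: row k U.
  by rewrite -row_mul US; apply/rowP => j; rewrite mul_diag_mx !mxE.
have rowW k : row k W *m S = e 0 k *: row k W.
  by rewrite -row_mul WS; apply/rowP => j; rewrite mul_diag_mx !mxE.
have dotE (A B : 'M[R]_N) k l : (A *m B^T) k l = (row k A *m (row l B)^T) 0 0.
  by rewrite !mxE; apply: eq_bigr => j _; rewrite !mxE.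
have UUe k l : (row k U *m (row l U)^T) 0 0 + (row k W *m (row l W)^T) 0 0 = (k == l)%:R.
  by rewrite -!dotE; have /matrixP/(_ k l) := UU; rewrite [LHS]mxE [RHS]mxE.
have WUe k l : (row k W *m (row l U)^T) 0 0 = (row k U *m (row l W)^T) 0 0.
  by rewrite -!dotE WU.
have dotw a b : ((a *: w) *m (b *: w)^T) 0 0 = a * b.
  by rewrite linearZ /= -scalemxAl -scalemxAr [LHS]mxE [X in _ * X]mxE w_norm mulr1.
(* Row [k] of [U] or of [W] is nonzero because their squared norms add up to 1. *)
have e_le1 k : e 0 k <= 1.
  have [U0|/(eigenvalue_le1 (rowU k))//] := eqVneq (row k U) 0.
  have [W0|/(eigenvalue_le1 (rowW k))//] := eqVneq (row k W) 0.
  have := UUe k k; rewrite U0 W0 eqxx mul0mx mxE addr0.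
  by move/esym/eqP; rewrite oner_eq0.
have e_eq1 k : e 0 k = 1 -> exists a b, [/\ row k U = a *: w, row k W = b *: w
    & a ^+ 2 + b ^+ 2 = 1].
  move=> ek; have := rowU k; have := rowW k; rewrite ek !scale1r.
  move=> /eigenvector1[b Wb] /eigenvector1[a Ua]; exists a, b; split => //.
  by have := UUe k k; rewrite Ua Wb !dotw eqxx.
have [k0 ek0] : exists k, e 0 k = 1.
  have : root (char_poly S) 1.
    rewrite -eigenvalue_root_char; apply/eigenvalueP; exists w.
      by rewrite scale1r.
    by apply/eqP => w0; move: w_norm; rewrite w0 mul0mx mxE => /esym/eqP; rewrite oner_eq0.
  rewrite -char_polyS chE rootE horner_prod prodf_seq_eq0 => /hasP[k _ /=].
  by rewrite !hornerE subr_eq0 => /eqP h; exists k.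
exists U, W, e, k0; split => //; split => //.
- move=> x; have [a [b [Ua Wb ab]]] := e_eq1 _ ek0.
  have dotx (A : 'M[R]_N) c : row k0 A = c *: w -> (x *m A^T) 0 k0 = c * (x *m w^T) 0 0.
    move=> Ac; rewrite !mxE mulr_sumr; apply: eq_bigr => j _.
    have /rowP/(_ j) := Ac; rewrite [row _ _ _ _]mxE [A^T _ _]mxE => ->.
    by rewrite !mxE; ring.
  by rewrite (dotx _ _ Ua) (dotx _ _ Wb) !exprMn -mulrDl ab mul1r.
split => // k kk0; rewrite lt_neqAle e_le1 andbT; apply/eqP => ek.
have [a [b [Ua Wb ab]]] := e_eq1 _ ek0.
have [a' [b' [Ua' Wb' ab']]] := e_eq1 _ ek.
have h1 : a * a' + b * b' = 0.
  by have := UUe k0 k; rewrite Ua Wb Ua' Wb' !dotw eq_sym (negbTE kk0).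
have h2 : b * a' - a * b' = 0.
  by have := WUe k0 k; rewrite Ua Wb Ua' Wb' !dotw => ->; rewrite subrr.
(* The two-square identity, whose left side is 0 and right side 1. *)
have : (a * a' + b * b') ^+ 2 + (b * a' - a * b') ^+ 2 = (a ^+ 2 + b ^+ 2) * (a' ^+ 2 + b' ^+ 2) by ring.
rewrite h1 h2 ab ab'; lra.
Qed.

(** In spectral coordinates the [k0] term has eigenvalue 1 and gives the squared mean; all others
    have eigenvalue at most lam <= l. *)
Lemma spectral_gap (lam : R) : second_eigenvalue P lam ->
  lam < 1 /\ forall (l : R) (g : 'I_N -> R), lam <= l ->
  \sum_i \sum_j pi i * P i j * (g i * g j) <=
  l * \sum_i pi i * g i ^+ 2 + (1 - l) * (\sum_i pi i * g i) ^+ 2.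
Proof.
have [U [W [e [k0 [[UU US WS k0w [ek0 ek]] chE]]]]] := reversible_spectral.
move=> [s [s_sorted s_size chs ->]].
have mem_s x : (x \in s) = [exists k, x == e 0 k].
  have := congr1 (root^~ x) (etrans (esym chs) chE); rewrite /= root_prod_XsubC => ->.
  rewrite rootE horner_prod; apply/prodf_eq0/existsP => [[k _]|[k /eqP ->]].
    by rewrite !hornerE subr_eq0; exists k.
  by exists k; rewrite // !hornerE subrr.
case: s s_sorted s_size chs mem_s => [|s0 [|s1 s]]//= /andP[s10 s_sorted] _ chs mem_s.
have s_le1 x : x \in [:: s0, s1 & s] -> x <= 1.
  rewrite mem_s => /existsP[k /eqP ->]; have [->|/ek/ltW//] := eqVneq k k0.
  by rewrite ek0.
have tr : transitive (fun a b : R => b <= a).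
  by move=> x y z xy yz; exact: le_trans yz xy.
have s_le x : x \in s -> x <= s1.
  by have /allP := order_path_min tr s_sorted => /[apply].
have s01 : s0 = 1.
  apply/eqP; rewrite eq_le s_le1 ?mem_head//=.
  have : 1 \in [:: s0, s1 & s] by rewrite mem_s; apply/existsP; exists k0; rewrite ek0.
  rewrite !inE => /or3P[/eqP <-//|/eqP ->//|/s_le h]; exact: le_trans h s10.
have s1_lt1 : s1 < 1.
  rewrite lt_neqAle s_le1 ?inE ?eqxx ?orbT// andbT; apply/eqP => s11.
  (* Cancel X - 1 from the two factorisations and evaluate at 1: if s1 were 1, some e_k with k != k0
     would be 1 as well. *)
  move: chE; rewrite chs !big_cons (bigD1 k0)//= ek0 s01 s11.
  move=> /mulfI; rewrite polyXsubC_eq0 => /(_ isT) /(congr1 (fun p => p.[1])).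
  rewrite hornerM !hornerE subrr mul0r horner_prod => /esym/eqP/prodf_eq0[k kk0].
  by rewrite !hornerE subr_eq0 => /eqP h; have := ek k kk0; rewrite -h ltxx.
split => // l g s1l.
have e_le k : k != k0 -> e 0 k <= l.
  move=> kk0; apply: le_trans s1l.
  have : e 0 k \in [:: s0, s1 & s] by rewrite mem_s; apply/existsP; exists k.
  rewrite !inE => /or3P[/eqP h|/eqP ->//|/s_le//].
  by have := ek k kk0; rewrite h s01 ltxx.
rewrite -S_form -norm_form; set x := \row_i _.
have -> : \sum_i pi i * g i = (x *m w^T) 0 0.
  by rewrite mxE; apply: eq_bigr => i _; rewrite -w_sqr !mxE; ring.
rewrite -k0w.
have -> : x *m S *m x^T =
    x *m U^T *m diag_mx e *m (x *m U^T)^T + x *m W^T *m diag_mx e *m (x *m W^T)^T.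
  by rewrite -[S]mul1mx -UU mulmxDl -!mulmxA US WS mulmxDl mulmxDr !trmx_mul !trmxK !mulmxA.
have -> : x *m x^T = x *m U^T *m (x *m U^T)^T + x *m W^T *m (x *m W^T)^T.
  by rewrite -{1}[x]mulmx1 -UU mulmxDr mulmxDl !trmx_mul !trmxK !mulmxA.
move: (x *m U^T) (x *m W^T) => y z.
rewrite mxE !diag_form [X in _ <= l * X + _]mxE.
have dot (v : 'rV[R]_N) : (v *m v^T) 0 0 = \sum_k v 0 k ^+ 2.
  by rewrite mxE; apply: eq_bigr => k _; rewrite mxE expr2.
rewrite !dot -!big_split /= (bigD1 k0)//= ek0 [X in _ <= _ * X + _](bigD1 k0)//=.
have : \sum_(k | k != k0) (e 0 k * y 0 k ^+ 2 + e 0 k * z 0 k ^+ 2) <=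
   l * \sum_(k | k != k0) (y 0 k ^+ 2 + z 0 k ^+ 2).
  rewrite mulr_sumr; apply: ler_sum => k kk0; rewrite -mulrDr.
  by apply: ler_wpM2r; [rewrite addr_ge0 ?sqr_ge0|exact: e_le].
lra.
Qed.

End SpectralGap.

(** * Moment generating function *)

(* Cauchy-Schwarz with the weights [r - l], written as the nonnegativity of a
   sum of squares. *)
Lemma rank_one_perturbation_le (R : realFieldType) (I : finType) (pi r h : I -> R) (l : R) :
  (forall i, 0 <= pi i) -> l <= 1 -> (forall i, l < r i) ->
  (1 - l) * \sum_i pi i / (r i - l) <= 1 ->
  l * \sum_i pi i * h i ^+ 2 + (1 - l) * (\sum_i pi i * h i) ^+ 2 <=
  \sum_i pi i * r i * h i ^+ 2.
Proof.
move=> pi0 l1 lr hs; set M := \sum_i pi i * h i.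
pose c := (1 - l) * M.
have : 0 <= \sum_i pi i * (r i - l) * (h i - c / (r i - l)) ^+ 2.
  apply: sumr_ge0 => i _; rewrite mulr_ge0 ?sqr_ge0// mulr_ge0// subr_ge0.
  exact: ltW.
have -> : \sum_i pi i * (r i - l) * (h i - c / (r i - l)) ^+ 2 =
  \sum_i pi i * r i * h i ^+ 2 - l * (\sum_i pi i * h i ^+ 2) - 2 * c * M
  + c ^+ 2 * \sum_i pi i / (r i - l).
  rewrite !mulr_sumr -!sumrB -big_split /=; apply: eq_bigr => i _.
  by field; rewrite subr_eq0 gt_eqF.
have : 0 <= (1 - l) * M ^+ 2 by rewrite mulr_ge0 ?sqr_ge0// subr_ge0.
move=> /ler_wpM2l/(_ _ _ hs); rewrite mulr1 /c.
lra.
Qed.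

Lemma big_tuple_cons (R : nmodType) (T : finType) n (F : seq T -> R) :
  \sum_(xs : n.+1.-tuple T) F xs = \sum_x \sum_(xs : n.-tuple T) F (x :: xs).
Proof.
rewrite pair_bigA /= (reindex (fun p : T * n.-tuple T => [tuple of p.1 :: p.2])) //=.
exists (fun xs : n.+1.-tuple T => (thead xs, [tuple of behead xs])) => [[x xs] _|xs _] /=.
  by congr pair; apply: val_inj.
by rewrite -tuple_eta.
Qed.

Section MomentGeneratingFunction.
Variables (R : realType) (N : nat) (P : 'M[R]_N) (pi d : 'I_N -> R) (theta : R).
Hypothesis P_ge0 : forall i j, 0 <= P i j.
Hypothesis pi_ge0 : forall i, 0 <= pi i.
Hypothesis P_rev : reversible P pi.
Hypothesis d_ge0 : forall i, 0 <= d i.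
Hypothesis theta_gt0 : 0 < theta.
Hypothesis form_le : forall g : 'I_N -> R,
  \sum_i \sum_j pi i * P i j * ((d i * g i) * (d j * g j)) <=
  theta * \sum_i pi i * d i * g i ^+ 2.
Hypothesis mean_le : \sum_i pi i * d i <= theta.

(* The tilted kernel [K] is self-adjoint for the inner product [ip] of
   [l^2(d pi)]. *)
Let K (g : 'I_N -> R) (i : 'I_N) := \sum_j P i j * d j * g j.
Let ip (g h : 'I_N -> R) := \sum_i pi i * d i * (g i * h i).
Let u m := iter m K (fun=> 1).

Let ipK g h : ip g (K h) = \sum_i \sum_j pi i * P i j * ((d i * g i) * (d j * h j)).
Proof.
by apply: eq_bigr => i _; rewrite !mulr_sumr; apply: eq_bigr => j _; ring.
Qed.

Let ipC g h : ip g h = ip h g.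
Proof. by apply: eq_bigr => i _; rewrite [g i * _]mulrC. Qed.

Let K_adj g h : ip (K g) h = ip g (K h).
Proof.
rewrite ipC !ipK exchange_big /=; apply: eq_bigr => i _; apply: eq_bigr => j _.
by rewrite P_rev; ring.
Qed.

Let ip_ge0 g : 0 <= ip g g.
Proof. by apply: sumr_ge0 => i _; rewrite -expr2 mulr_ge0 ?sqr_ge0 ?mulr_ge0. Qed.

Let formK_le g : ip g (K g) <= theta * ip g g.
Proof. by rewrite ipK. Qed.

(** The kernel is nonnegative, so |ip g (K g)| is at most the form at |g|, to which the upper bound
    applies. *)
Let formK_ge g : - (theta * ip g g) <= ip g (K g).
Proof.
have := form_le (fun i => `|g i|); rewrite ipK.
have -> : \sum_i pi i * d i * `|g i| ^+ 2 = ip g g.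
  by apply: eq_bigr => i _; rewrite real_normK ?num_real// expr2.
move=> h; rewrite lerNl; apply: le_trans h.
rewrite -sumrN; apply: ler_sum => i _; rewrite -sumrN; apply: ler_sum => j _.
rewrite -mulrN; apply: ler_wpM2l; first exact: mulr_ge0.
apply: le_trans (ler_norm _) _; rewrite normrN !normrM.
by rewrite (ger0_norm (d_ge0 i)) (ger0_norm (d_ge0 j)).
Qed.

Let ipD g h k (a b : R) : ip (fun i => a * g i + b * h i) k = a * ip g k + b * ip h k.
Proof.
by rewrite /ip !mulr_sumr -big_split; apply: eq_bigr => i _ /=; ring.
Qed.

Let ipDr k g h (a b : R) : ip k (fun i => a * g i + b * h i) = a * ip k g + b * ip k h.
Proof. by rewrite ipC ipD [ip g k]ipC [ip h k]ipC. Qed.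

Let ip_quad g h (b : R) :
  ip (fun i => 1 * g i + b * h i) (fun i => 1 * g i + b * h i) =
  ip g g + 2 * b * ip g h + b ^+ 2 * ip h h.
Proof.
by rewrite ipD !ipDr [ip h g]ipC; ring.
Qed.

Let ipK_quad g h (b : R) :
  ip (fun i => 1 * g i + b * h i) (K (fun i => 1 * g i + b * h i)) =
  ip g (K g) + 2 * b * ip g (K h) + b ^+ 2 * ip h (K h).
Proof.
rewrite -K_adj ipDr !K_adj !ipD -[ip h (K g)]K_adj [ip (K h) g]ipC; ring.
Qed.

(** A two-sided bound on the form of a self-adjoint operator bounds its norm: polarisation with g +
    K g / theta and g - K g / theta. *)
Let normK g : ip (K g) (K g) <= theta ^+ 2 * ip g g.
Proof.
have t0 : theta != 0 by rewrite gt_eqF.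
pose h := K g; pose b := theta^-1.
have h1 := formK_le (fun i => 1 * g i + b * h i).
have h2 := formK_ge (fun i => 1 * g i + (- b) * h i).
rewrite ipK_quad ip_quad in h1; rewrite ipK_quad ip_quad in h2.
have e : ip g (K h) = ip h h by rewrite -K_adj.
rewrite e in h1 h2.
have : 4 * b * ip h h <= 2 * theta * (ip g g + b ^+ 2 * ip h h) by lra.
rewrite -(ler_pM2l theta_gt0).
have -> : theta * (4 * b * ip h h) = 4 * ip h h by rewrite /b; field.
have -> : theta * (2 * theta * (ip g g + b ^+ 2 * ip h h)) =
  2 * theta ^+ 2 * ip g g + 2 * ip h h by rewrite /b; field.
rewrite /h; lra.
Qed.

Let ip_u a b : ip (u a) (u b) = ip (fun=> 1) (u (a + b)).
Proof.
elim: a b => // a IH b; rewrite [u a.+1]iterS K_adj -[K (u b)]/(u b.+1) IH.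
by rewrite addnS addSn.
Qed.

(** Self-adjointness splits [m] evenly between the two sides, leaving a squared norm; for odd [m]
    the remaining [K] is absorbed by the form bound. *)
Let ip_u_le m : ip (fun=> 1) (u m) <= theta ^+ m * ip (fun=> 1) (fun=> 1).
Proof.
have sq k : ip (u k) (u k) <= theta ^+ (k + k) * ip (fun=> 1) (fun=> 1).
  elim: k => [|k IH]; first by rewrite mul1r.
  apply: le_trans (normK _) _.
  rewrite addSn addnS -[(k + k).+2]/(2 + (k + k))%N exprD -mulrA.
  by apply: ler_wpM2l IH; rewrite sqr_ge0.
rewrite -(odd_double_half m) -addnn; case: (odd m); last first.
  by rewrite add0n -ip_u.
rewrite (add1n (_ + _)) -addnS -ip_u addnS exprS -mulrA; apply: le_trans (formK_le _) _.
by rewrite ler_pM2l.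
Qed.

(** Feynman-Kac: [u m i] is the mean of the product of [d] over the [m] states that follow [i]. *)
Let u_tuple m i : u m i = \sum_(s : m.-tuple 'I_N) chain_weight P i s * \prod_(x <- s) d x.
Proof.
elim: m i => [|m IH] i.
  rewrite (bigD1 [tuple])//= big_nil mulr1 big1 ?addr0// => s /eqP[].
  exact: tuple0.
rewrite (@big_tuple_cons _ _ _ (fun s => chain_weight P i s * \prod_(x <- s) d x)).
rewrite [u _]iterS; apply: eq_bigr => j _; rewrite -/(u m) IH mulr_sumr.
by apply: eq_bigr => s _; rewrite big_cons /=; ring.
Qed.

Lemma mgf_le n : (0 < n)%N ->
  \sum_(xs : n.-tuple 'I_N) path_prob P pi xs * \prod_(x <- xs) d x <= theta ^+ n.
Proof.
case: n => // n _.
rewrite (@big_tuple_cons _ _ _ (fun s => path_prob P pi s * \prod_(x <- s) d x)) /=.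
have -> : \sum_x \sum_(xs : n.-tuple 'I_N)
    pi x * chain_weight P x xs * \prod_(x0 <- (x :: xs)) d x0 = ip (fun=> 1) (u n).
  apply: eq_bigr => x _; rewrite u_tuple !mulr_sumr; apply: eq_bigr => s _.
  by rewrite big_cons; ring.
(* There are n + 1 states but only n applications of [K]; the last factor theta comes from
   [mean_le]. *)
apply: le_trans (ip_u_le n) _; rewrite exprSr ler_pM2l ?exprn_gt0//.
by rewrite /ip; under eq_bigr do rewrite !mulr1.
Qed.

End MomentGeneratingFunction.

(** * Tail bound *)

Lemma geometric_mean_gt (R : realType) (l A B f : R) : 0 <= l -> l < A -> l < B ->
  0 <= f <= 1 -> l < expR ((1 - f) * ln B + f * ln A).
Proof.
move=> l0 lA lB /andP[f0 f1].
(* The case l = 0 is separate because [ln] has only a default value at 0. *)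
have [->|l_neq0] := eqVneq l 0; first exact: expR_gt0.
have l_gt0 : 0 < l by rewrite lt0r l_neq0.
have hA : ln l < ln A by rewrite ltr_ln// posrE ?(lt_trans l_gt0).
have hB : ln l < ln B by rewrite ltr_ln// posrE ?(lt_trans l_gt0).
rewrite -[X in X < _](lnK (x := l)) ?posrE// ltr_expR.
have [->|fn1] := eqVneq f 1; first by rewrite subrr mul0r add0r mul1r.
have h1 : 0 < (1 - f) * (ln B - ln l).
  by rewrite mulr_gt0 ?subr_gt0// lt_neqAle fn1.
have h2 : 0 <= f * (ln A - ln l) by rewrite mulr_ge0// subr_ge0 ltW.
lra.
Qed.

(** Jensen's inequality from the tangents at [r]: the first-order terms cancel because ln r is the
    weighted mean of ln A and ln B. *)
Lemma inv_geometric_mean_le (R : realType) (l A B f : R) : 0 <= l -> l < A -> l < B ->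
  0 <= f <= 1 ->
  (expR ((1 - f) * ln B + f * ln A) - l)^-1 <= (1 - f) / (B - l) + f / (A - l).
Proof.
move=> l0 lA lB f01; have lr := geometric_mean_gt l0 lA lB f01.
set r := expR _ in lr *; case/andP: f01 => f0 f1.
have f1' : 0 <= 1 - f by rewrite subr_ge0.
have h1 := ler_wpM2l f1' (tangent_inv l0 lr lB).
have h2 := ler_wpM2l f0 (tangent_inv l0 lr lA).
have lnr : ln r = (1 - f) * ln B + f * ln A by rewrite /r expRK.
apply: le_trans (lerD h1 h2).
by rewrite lnr le_eqVlt; apply/orP; left; apply/eqP; ring.
Qed.

Section TailBound.
Variables (R : realType) (N : nat) (P : 'M[R]_N) (pi f : 'I_N -> R) (l A B : R).
Hypothesis P_stoch : stochastic P.
Hypotheses (pi_stat : stationary P pi) (P_rev : reversible P pi).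
Hypothesis f01 : forall i, 0 <= f i <= 1.
Hypotheses (l01 : 0 <= l < 1) (lA : l < A) (lB : l < B) (AB : ln A <= ln B).
Hypothesis gap : forall g : 'I_N -> R,
  \sum_i \sum_j pi i * P i j * (g i * g j) <=
  l * \sum_i pi i * g i ^+ 2 + (1 - l) * (\sum_i pi i * g i) ^+ 2.

Let p := \sum_i pi i * f i.
Hypothesis curve : (1 - l) * (p / (A - l) + (1 - p) / (B - l)) = 1.

(** The tilt is chosen so that theta = B and theta e^{-t} = A; then [r i] is theta / [d i]. *)
Let t := ln B - ln A.
Let d i := expR (t * f i).
Let r i := expR ((1 - f i) * ln B + f i * ln A).

Let l0 : 0 <= l. Proof. by case/andP: l01. Qed.
Let l1 : 0 <= 1 - l. Proof. by case/andP: l01 => _ ?; rewrite subr_ge0 ltW. Qed.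
Let B_gt0 : 0 < B. Proof. exact: le_lt_trans lB. Qed.
Let pi_ge0 i : 0 <= pi i. Proof. by case: pi_stat => -[]. Qed.
Let pi_sum : \sum_i pi i = 1. Proof. by case: pi_stat => -[]. Qed.

Let rd i : r i * d i = B.
Proof. by rewrite -expRD /t -[RHS]lnK ?posrE//; congr expR; ring. Qed.

(** The Jensen bound is affine in [f i], so its average under [pi] depends on the mean [p] alone and
    is the curve equation. *)
Let weight_le : (1 - l) * \sum_i pi i / (r i - l) <= 1.
Proof.
rewrite -[X in _ <= X]curve; apply: ler_wpM2l => //.
have -> : p / (A - l) + (1 - p) / (B - l) =
    \sum_i pi i * ((1 - f i) / (B - l) + f i / (A - l)).
  rewrite -[X in X - p]pi_sum /p -sumrB !mulr_suml -big_split /=.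
  by apply: eq_bigr => i _; ring.
by apply: ler_sum => i _; apply: ler_wpM2l => //; exact: inv_geometric_mean_le.
Qed.

Let tilted_form_le (g : 'I_N -> R) :
  l * \sum_i pi i * (d i * g i) ^+ 2 + (1 - l) * (\sum_i pi i * (d i * g i)) ^+ 2 <=
  B * \sum_i pi i * d i * g i ^+ 2.
Proof.
apply: le_trans (@rank_one_perturbation_le _ _ _ r _ _ pi_ge0 _ _ _) _ => //.
- by rewrite -subr_ge0.
- by move=> i; exact: geometric_mean_gt.
rewrite mulr_sumr le_eqVlt; apply/orP; left; apply/eqP; apply: eq_bigr => i _.
by rewrite -(rd i); ring.
Qed.

Let mean_le : \sum_i pi i * d i <= B.
Proof.
set M := \sum_i _.
have M_gt0 : 0 < M.
  have h i : pi i <= pi i * d i.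
    apply: ler_peMr => //; rewrite /d -expR0 ler_expR mulr_ge0//.
      by rewrite subr_ge0.
    by case/andP: (f01 i).
  by apply: lt_le_trans (ltr01) _; rewrite -pi_sum; apply: ler_sum.
have := tilted_form_le (fun=> 1).
under eq_bigr do rewrite mulr1; under [X in _ * X ^+ 2]eq_bigr do rewrite mulr1.
under [X in _ <= _ * X]eq_bigr do rewrite expr1n mulr1.
rewrite -/M => h; have ME : \sum_i pi i * d i = M by [].
move: M ME M_gt0 h => M ME M_gt0 h.
(* With M^2 <= sum pi d^2, the form bound [h] at g = 1 gives M^2 <= B M, and M > 0 is cancelled. *)
have var : M ^+ 2 <= \sum_i pi i * d i ^+ 2.
  have : 0 <= \sum_i pi i * (d i - M) ^+ 2.
    by apply: sumr_ge0 => i _; rewrite mulr_ge0 ?sqr_ge0.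
  have -> : \sum_i pi i * (d i - M) ^+ 2 =
     \sum_i pi i * d i ^+ 2 - 2 * M * (\sum_i pi i * d i) + M ^+ 2 * \sum_i pi i.
    by rewrite !mulr_sumr -sumrB -big_split /=; apply: eq_bigr => i _; ring.
  by rewrite pi_sum ME; lra.
rewrite -(ler_pM2r M_gt0); have := ler_wpM2l l0 var; lra.
Qed.

(** Chernoff's bound: on the event, exp (t (S_n - n a)) >= 1, and e^{-t n a} B^n is the right-hand
    side. *)
Lemma tail_le n a : (0 < n)%N ->
  prob_Sn_ge P pi f n (n%:R * a) <= expR (n%:R * (a * ln A + (1 - a) * ln B)).
Proof.
move=> n0.
have P_ge0 i j : 0 <= P i j by case: P_stoch.
have d_ge0 i : 0 <= d i by exact: expR_ge0.
have mgf := @mgf_le R N P pi d B P_ge0 pi_ge0 P_rev d_ge0 B_gt0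
  (fun g => le_trans (gap _) (tilted_form_le g)) mean_le n n0.
have prob_ge0 (xs : seq 'I_N) : 0 <= path_prob P pi xs.
  case: xs => // x s /=; rewrite mulr_ge0//.
  by elim: s x => //= y s IH x; rewrite mulr_ge0.
have dE (xs : seq 'I_N) : \prod_(x <- xs) d x = expR (t * \sum_(x <- xs) f x).
  by rewrite mulr_sumr expR_sum.
have t0 : 0 <= t by rewrite subr_ge0.
have -> : expR (n%:R * (a * ln A + (1 - a) * ln B)) = expR (- (t * (n%:R * a))) * B ^+ n.
  rewrite -[B in B ^+ n]lnK ?posrE// -expRM_natl -expRD.
  by congr expR; rewrite /t; ring.
apply: le_trans (ler_wpM2l (expR_ge0 _) mgf); rewrite mulr_sumr /prob_Sn_ge.
rewrite [leLHS]big_mkcond /=; apply: ler_sum => xs _.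
case: ifP => [h|_]; last by rewrite mulr_ge0 ?expR_ge0// mulr_ge0// prodr_ge0.
rewrite mulrCA; apply: ler_peMr => //.
by rewrite dE -expRD -[X in X <= _]expR0 ler_expR addrC -mulrBr mulr_ge0// subr_ge0.
Qed.

End TailBound.

(** * Closed form of the bound and its Gaussian majorant *)

Lemma powR_expR (R : realType) (x y : R) : 0 < x -> powR x y = expR (y * ln x).
Proof. by move=> x0; rewrite /powR gt_eqF. Qed.

Theorem theorem1 (R : realType) (N : nat) (P : 'M[R]_N) (pi : 'I_N -> R)
  (lam : R) (f : 'I_N -> R) (mu eps : R) (n : nat) :
  stochastic P -> irreducible P -> aperiodic P ->
  stationary P pi -> reversible P pi ->
  second_eigenvalue P lam ->
  (forall i, 0 <= f i <= 1) ->
  mu = \sum_i pi i * f i -> 0 < mu < 1 ->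
  0 < eps -> mu + eps < 1 -> (1 <= n)%N ->
  let lam0 := Num.max 0 lam in
  let mub := 1 - mu in
  let Delta := 1 + 4 * lam0 * (mu + eps) * (mub - eps)
                   / (mu * mub * (1 - lam0) ^+ 2) in
  let bound :=
    powR ((mu + mub * lam0) / (1 - 2 * (mub - eps) / (1 + Num.sqrt Delta)))
         (n%:R * (mu + eps)) *
    powR ((mub + mu * lam0) / (1 - 2 * (mu + eps) / (1 + Num.sqrt Delta)))
         (n%:R * (mub - eps)) in
  prob_Sn_ge P pi f n (n%:R * (mu + eps)) <= bound /\
  bound <= expR (- 2 * ((1 - lam0) / (1 + lam0)) * n%:R * eps ^+ 2).
Proof.
move=> P_stoch P_irr _ pi_stat P_rev lamP f01 muE mu01 eps0 mueps n0 l q Delta.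
have [lam1 gap] := spectral_gap P_stoch P_irr pi_stat P_rev lamP.
have laml : lam <= l by rewrite /l le_max lexx orbT.
have l01 : 0 <= l < 1 by rewrite /l le_max lexx gt_max ltr01 lam1.
move: l laml l01 {gap}(gap l ^~ laml) @Delta => l _ l01 gap Delta.
pose a := mu + eps; pose v := 2 / (1 + Num.sqrt Delta).
have [l0 l1] := andP l01; have [mu0 mu1] := andP mu01.
have a01 : 0 < a < 1 by rewrite /a; apply/andP; split; lra.
have bE : q - eps = 1 - a by rewrite /q /a; ring.
have L0 : 0 < 1 - l by rewrite subr_gt0.
have q0 : 0 < 1 - mu by rewrite subr_gt0.
have b0 : 0 < 1 - a by rewrite subr_gt0; case/andP: a01.
have a0 : 0 < a by case/andP: a01.
have Delta1 : 1 <= Delta.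
  rewrite /Delta bE /q -/a lerDl divr_ge0 ?mulr_ge0// ?ltW// exprn_gt0//.
have s1 : 1 <= Num.sqrt Delta by rewrite -sqrtr1 ler_wsqrtr.
have s2 : Num.sqrt Delta ^+ 2 = Delta by rewrite sqr_sqrtr// (le_trans ler01).
have v01 : 0 < v <= 1.
  by rewrite /v divr_gt0//= ?ler_pdivrMr; lra.
have vE : (1 - l) ^+ 2 * mu * (1 - mu) * (1 - v) = l * a * (1 - a) * v ^+ 2.
  have sp : 1 + Num.sqrt Delta != 0 by rewrite gt_eqF//; lra.
  have e1 : (1 - l) ^+ 2 * mu * (1 - mu) * (Num.sqrt Delta ^+ 2 - 1) = 4 * l * a * (1 - a).
    rewrite s2 /Delta bE /q -/a; field.
    by rewrite !gt_eqF.
  have -> : 1 - v = (Num.sqrt Delta ^+ 2 - 1) / (1 + Num.sqrt Delta) ^+ 2.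
    by rewrite /v; field.
  by rewrite mulrA e1 /v; field.
have -> : 2 * (q - eps) / (1 + Num.sqrt Delta) = (1 - a) * v by rewrite bE /v; ring.
have -> : 2 * (mu + eps) / (1 + Num.sqrt Delta) = a * v by rewrite /v /a; ring.
rewrite bE -/a /q.
have lA := base_gtl l01 mu01 a01 v01.
have lB := base_gtr l01 mu01 a01 v01.
have curve := base_curve l01 mu01 a01 v01 vE.
have AB := base_le l01 mu01 a01 v01 vE.
have Amin := base_min l01 mu01 a01 v01 vE.
move: (_ / _) (_ / _) lA lB curve AB Amin => B A lA lB curve AB Amin.
rewrite !powR_expR ?(le_lt_trans l0)// -expRD.
have -> : n%:R * a * ln A + n%:R * (1 - a) * ln B =
  n%:R * (a * ln A + (1 - a) * ln B) by ring.
split.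
  rewrite muE in curve.
  by apply: (tail_le P_stoch pi_stat P_rev f01 l01 lA lB _ gap curve) => //; apply: AB; rewrite /a; lra.
rewrite ler_expR.
(* The exponent at (u - t, u) is t^2 / (8 g) - t eps, minimised at t = 4 g eps with value - 2 g
   eps^2. *)
pose g := (1 - l) / (1 + l); pose t := 4 * g * eps.
have g0 : 0 < g by rewrite /g divr_gt0//; lra.
have t0 : 0 < t by rewrite /t pmulr_rgt0 // pmulr_rgt0 // ltr0n.
have [lx ly xy] := gaussian_point l01 mu01 t0.
have := Amin _ _ lx ly xy; rewrite !expRK -/g => h.
have -> : - 2 * g * n%:R * eps ^+ 2 = n%:R * (- 2 * g * eps ^+ 2) by ring.
apply: ler_wpM2l => //; apply: le_trans h _.
rewrite le_eqVlt; apply/orP; left; apply/eqP; rewrite /t /a; field.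
by rewrite gt_eqF.
Qed.
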